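(* Let $\mathcal{H}=\mathcal{H}_1\otimes\cdots\otimes\mathcal{H}_n$ be a tensor product of finite-dimensional complex Hilbert spaces, $\ket{\psi}\in\mathcal{H}$ a unit vector and $\rho=\ket{\psi}\bra{\psi}$. For each $k$ with $0\le k\le n$ let $\mathrm{Harm}^k(\rho)\subseteq\Omega^k(\rho)$ be the space of harmonic entanglement $k$-forms, i.e. those $\omega$ with $d^k\omega=0$ and $\delta^{k-1}\omega=0$. Then $$\mathrm{Harm}^k(\rho)\cong\mathrm{Harm}^{n-k}(\rho).$$
   Context: Notation. For $I\subseteq\{1,\dots,n\}$, $\mathcal{H}_I=\bigotimes_{i\in I}\mathcal{H}_i$ with factors in increasing order; $\rho_I=\mathrm{tr}_{I^C}(\rho)$ is the reduced density matrix (partial trace over the complementary factors), $s_I$ is the orthogonal projection onto $\mathrm{im}(\rho_I)$, and $\mathcal{O}|_{\rho_I}=s_I\mathcal{O}s_I$ for an operator $\mathcal{O}$ on $\mathcal{H}_I$. Entanglement forms. $\Omega^0(\rho)=\mathbb{C}$, and for $1\le k\le n$, $\Omega^k(\rho)=\prod_{|I|=k}\{s_I\mathcal{O}s_I:\mathcal{O}\in\mathrm{End}(\mathcal{H}_I)\}$ (tuples $\omega=(\omega_I)_{|I|=k}$ indexed by the $k$-element subsets). Signed tensor product. For $j\notin J$ and an operator $X$ on $\mathcal{H}_J$, $\mathbb{I}_j\,\widehat{\otimes}\,X$ denotes $(-1)^{p}$ times the operator on $\mathcal{H}_{J\cup\{j\}}$ (factors in increasing order) acting as the identity on the factor $\mathcal{H}_j$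 and as $X$ on the remaining factors, where $p=\#\{i\in J: i<j\}$. Coboundary. $d^0\lambda=(\lambda s_{\{1\}},\dots,\lambda s_{\{n\}})$ for $\lambda\in\mathbb{C}$; for $1\le m\le n-1$, $d^m:\Omega^m(\rho)\to\Omega^{m+1}(\rho)$ has components $(d^m\omega)_I = \big(m\sum_{j\in I}\mathbb{I}_j\,\widehat{\otimes}\,\omega_{I\setminus\{j\}}\big)\big|_{\rho_I}$ for $|I|=m+1$; $d^n=0$. (This satisfies $d^{m}\circ d^{m-1}=0$.) Inner product. On $\Omega^0=\mathbb{C}$, $\langle z,w\rangle=z\bar w$. For $1\le k\le n$ and each $|I|=k$, take a Schmidt decomposition $\ket{\psi}=\sum_{\alpha=1}^{S}\lambda_\alpha\ket{\alpha_I}\otimes\ket{\alpha_{I^C}}$ of $\ket\psi$ with respect to the bipartition $\mathcal{H}_I\otimes\mathcal{H}_{I^C}$ (factors reordered; $\mathcal{H}_\emptyset=\mathbb{C}$), with $\lambda_\alpha>0$ and orthonormal $\ket{\alpha_I}$, which span $\mathrm{im}(\rho_I)$; write $(\omega_I)_{\alpha\beta}=\bra{\alpha_I}\omega_I\ket{\beta_I}$. Then $$\langle\omega,\eta\rangle=\sum_{|I|=k}\sum_{\alpha,\beta=1}^{S}\lambda_\alpha\lambda_\beta\,(\omega_I)_{\alpha\beta}\,\overline{(\eta_I)_{\alpha\beta}},$$ which is positive definite and independent of the choice of Schmidt bases. (In the paper this is defined as $\mathrm{tr}((\omega\wedge\ast\eta)|_{\rho})$ via a wedge product and Hodge star, and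 shown to equal this formula.) Codifferential. $\delta^{k-1}:\Omega^k(\rho)\to\Omega^{k-1}(\rho)$ is the adjoint of $d^{k-1}$ with respect to these inner products: $\langle d^{k-1}\omega,\eta\rangle=\langle\omega,\delta^{k-1}\eta\rangle$. For $k=0$, $\delta^{-1}=0$. *)

(* Defs.v *)
From HB Require Import structures.
From mathcomp Require Import all_boot all_order all_algebra.
From mathcomp Require Import complex.
From Stdlib Require Import ClassicalEpsilon.
Set Implicit Arguments. Unset Strict Implicit. Unset Printing Implicit Defensive.
Import Order.TTheory GRing.Theory Num.Theory.
Local Open Scope ring_scope.

Section EntForms.
Variable R : rcfType.
Local Notation C := (R[i]).
(* n tensor factors, factor i is C^(d i) with standard basis 'I_(d i) *)
Variables (n : nat) (d : 'I_n -> nat).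

Definition sub (I : {set 'I_n}) := {i : 'I_n | i \in I}.
(* basis of H_I = (x_i)_{i in I}; the factor order is the canonical one *)
Definition sidx (I : {set 'I_n}) := {dffun forall i : sub I, 'I_(d (val i))}.
Definition N (I : {set 'I_n}) := #|{: sidx I}|.
Definition op (I : {set 'I_n}) := 'M[C]_(N I).
Definition vec (I : {set 'I_n}) := 'cV[C]_(N I).

Definition adj (m p : nat) (A : 'M[C]_(m, p)) : 'M[C]_(p, m) :=
  (map_mx Num.conj A)^T.

Definition restr (J K : {set 'I_n}) (H : J \subset K) (x : sidx K) : sidx J :=
  @finfun (sub J) (fun i : sub J => 'I_(d (val i)))
    (fun i : sub J => x (exist _ (val i) (subsetP H _ (valP i)))).

Definition rst (J K : {set 'I_n}) (H : J \subset K) (u : 'I_(N K)) : 'I_(N J) :=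
  enum_rank (restr H (enum_val u)).

Definition rstT (J : {set 'I_n}) : 'I_(N [set: 'I_n]) -> 'I_(N J) :=
  rst (subsetT J).

Variable psi : vec [set: 'I_n].

(* reduced density matrix rho_I = tr_{I^C} |psi><psi| *)
Definition rho (I : {set 'I_n}) : op I :=
  \matrix_(a, a')
    \sum_(x : 'I_(N [set: 'I_n]) | rstT I x == a)
     \sum_(x' : 'I_(N [set: 'I_n]) | (rstT I x' == a') && (rstT (~: I) x == rstT (~: I) x'))
       psi x 0 * (psi x' 0)^*.

Definition is_orth_proj (m : nat) (P A : 'M[C]_m) : Prop :=
  P *m P = P /\ adj P = P /\ (P^T == A^T)%MS.

Definition supp_proj (I : {set 'I_n}) : op I :=
  epsilon (inhabits 0) (fun P => is_orth_proj P (rho I)).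

(* Omega^k(rho): tuples indexed by the k-subsets, omega_I = s_I O s_I *)
Definition eform := forall I : {set 'I_n}, op I.
Definition eform0 : eform := fun I => 0.
Definition eformD (w e : eform) : eform := fun I => w I + e I.
Definition eformZ (a : C) (w : eform) : eform := fun I => a *: w I.

Definition isForm (k : nat) (w : eform) : Prop :=
  (forall I : {set 'I_n}, #|I| = k -> w I = supp_proj I *m w I *m supp_proj I) /\
  (forall I : {set 'I_n}, #|I| <> k -> w I = 0).

(* signed tensor product  I_j (x)^ X  on H_I, for j in I, X on H_{I \ j} *)
Definition tensId (I : {set 'I_n}) (j : sub I) (X : op (I :\ val j)) : op I :=
  (-1) ^+ #|[set i in I :\ val j | (i < val j)%N]| *:
  \matrix_(u, v)
    (((enum_val u : sidx I) j == (enum_val v : sidx I) j)%:R *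
     X (rst (subD1set I (val j)) u) (rst (subD1set I (val j)) v)).

(* coboundary d^m (d^0 special; d^n = 0 automatically) *)
Definition dform (m : nat) (w : eform) : eform := fun I =>
  if m == 0%N then
    (if #|I| == 1%N then \tr (w set0) *: supp_proj I else 0)
  else if #|I| == m.+1 then
    supp_proj I *m
      (m%:R *: \sum_(j : sub I) @tensId I j (w (I :\ val j))) *m supp_proj I
  else 0.

Record schmidt (I : {set 'I_n}) := Schmidt {
  sS : nat;
  slam : 'I_sS -> C;
  sa : 'I_sS -> vec I;
  sb : 'I_sS -> vec (~: I) }.
Arguments sS {I} s.
Arguments slam {I} s _.
Arguments sa {I} s _.
Arguments sb {I} s _.

Definition is_schmidt (I : {set 'I_n}) (s : schmidt I) : Prop :=
  (forall al, 0 < slam s al) /\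
  (forall al be, (adj (sa s al) *m sa s be) 0 0 = (al == be)%:R) /\
  (forall al be, (adj (sb s al) *m sb s be) 0 0 = (al == be)%:R) /\
  (forall x, psi x 0 =
     \sum_al slam s al * sa s al (rstT I x) 0 * sb s al (rstT (~: I) x) 0).

Definition schmidt0 (I : {set 'I_n}) : schmidt I :=
  @Schmidt I 0 (fun _ => 0) (fun _ => 0) (fun _ => 0).

Definition schm (I : {set 'I_n}) : schmidt I :=
  epsilon (inhabits (schmidt0 I)) (@is_schmidt I).

Definition ip (k : nat) (w e : eform) : C :=
  if k == 0%N then \tr (w set0) * (\tr (e set0))^* else
  \sum_(I : {set 'I_n} | #|I| == k)
    \sum_(al : 'I_(sS (schm I))) \sum_(be : 'I_(sS (schm I)))
      slam (schm I) al * slam (schm I) be *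
      (adj (sa (schm I) al) *m w I *m sa (schm I) be) 0 0 *
      ((adj (sa (schm I) al) *m e I *m sa (schm I) be) 0 0)^*.

(* codifferential delta^{k-1} : Omega^k -> Omega^{k-1}, adjoint of d^{k-1};
   delta^{-1} = 0 *)
Definition codiff (k : nat) (e : eform) : eform :=
  if k == 0%N then eform0 else
  epsilon (inhabits eform0) (fun nu =>
    isForm k.-1 nu /\
    forall w, isForm k.-1 w -> ip k (dform k.-1 w) e = ip k.-1 w nu).

Definition Harm (k : nat) (w : eform) : Prop :=
  isForm k w /\ (forall I, dform k w I = 0) /\ (forall I, codiff k w I = 0).

End EntForms.

(* Main.v *)
Require Import Defs.
From HB Require Import structures.
From mathcomp Require Import all_boot all_order all_algebra.
From mathcomp Require Import complex.
From mathcomp Require Import reals.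
From Stdlib Require Import ClassicalEpsilon FunctionalExtensionality.
Import Order.TTheory GRing.Theory Num.Theory.
Local Open Scope ring_scope.
Set Implicit Arguments. Unset Strict Implicit. Unset Printing Implicit Defensive.

(** View [psi] as a matrix [M_I] from [H_(~: I)] to [H_I] with singular value
    decomposition [A L B^T], and let [U_I = A B^T] be its phase. The bilinear
    pairing [<w, e> = \sum_(#|I| = k) eps(I) <psi| w_I (x) e_(~: I) |psi>],
    where [eps(I)] is the sign of the shuffle [(I, ~: I)], satisfies
    [<d w, e> = (-1)^k <w, d e>] (with [d] free of its numerical factors), and
    [(star w)_(~: I) = eps(I) U_I^T w_I^T conj(U_I)] is a linear isomorphism,
    involutive up to sign, with [(w, e) = <w, star e^dagger>] for the inner
    product. Hence [w] is coclosed iff [star w] is closed, so harmonicity of [w]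
    means that [w] and [star w] are both closed, and [star] exchanges the two
    conditions. As the Schmidt bases of [I] and [~: I] are chosen independently,
    the argument needs that the phase [U_I] depends only on [M_I]; this follows
    from the uniqueness of positive square roots. *)

(** * Conjugate transposes and square roots of positive semidefinite matrices *)

Section Adjoint.
Variable R : rcfType.
Local Notation C := (R[i]).

Lemma adjE m p (A : 'M[C]_(m, p)) i j : adj A i j = (A j i)^*.
Proof. by rewrite !mxE. Qed.

Lemma adjK m p : cancel (@adj R m p) (@adj R p m).
Proof. by move=> A; apply/matrixP=> i j; rewrite !adjE conjCK. Qed.

Lemma adjM m p q (A : 'M[C]_(m, p)) (B : 'M[C]_(p, q)) :
  adj (A *m B) = adj B *m adj A.
Proof. by rewrite /adj map_mxM trmx_mul. Qed.

Lemma adjB m p (A B : 'M[C]_(m, p)) : adj (A - B) = adj A - adj B.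
Proof. by apply/matrixP=> i j; rewrite !mxE rmorphB. Qed.

Lemma adj_scale m p (a : C) (A : 'M[C]_(m, p)) : adj (a *: A) = a^* *: adj A.
Proof. by apply/matrixP=> i j; rewrite !mxE rmorphM. Qed.

Lemma adj_sum m p (I : finType) (P : pred I) (F : I -> 'M[C]_(m, p)) :
  adj (\sum_(i | P i) F i) = \sum_(i | P i) adj (F i).
Proof.
apply/matrixP=> i j; rewrite adjE !summxE rmorph_sum.
by apply: eq_bigr=> l _; rewrite adjE.
Qed.

Lemma adj_tr m p (A : 'M[C]_(m, p)) : adj A^T = (adj A)^T.
Proof. by apply/matrixP=> i j; rewrite !mxE. Qed.

Lemma adj_diag m (l : 'rV[C]_m) :
  (forall i, 0 < l 0 i) -> adj (diag_mx l) = diag_mx l.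
Proof.
move=> l_gt0; apply/matrixP=> i j; rewrite adjE !mxE eq_sym.
have [->|] := eqVneq i j; last by rewrite !mulr0n rmorph0.
by rewrite !mulr1n; apply/CrealP/gtr0_real/l_gt0.
Qed.

Lemma adj_mul_trE m p (A : 'M[C]_(m, p)) :
  \tr (adj A *m A) = \sum_i \sum_j `|A j i| ^+ 2.
Proof.
apply: eq_bigr => i _; rewrite mxE; apply: eq_bigr => j _.
by rewrite adjE mulrC -normCK.
Qed.

Lemma adj_mul_tr_ge0 m p (A : 'M[C]_(m, p)) : 0 <= \tr (adj A *m A).
Proof.
by rewrite adj_mul_trE; do 2![apply: sumr_ge0 => ? _]; rewrite exprn_ge0.
Qed.

Lemma adj_mul_tr_eq0 m p (A : 'M[C]_(m, p)) : \tr (adj A *m A) = 0 -> A = 0.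
Proof.
rewrite adj_mul_trE => /eqP; rewrite psumr_eq0; last first.
  by move=> i _; apply: sumr_ge0 => j _; rewrite exprn_ge0.
move=> /allP A0; apply/matrixP=> j i; rewrite mxE.
have := A0 i; rewrite mem_index_enum psumr_eq0 => [/(_ isT)/allP/(_ j)|]; last first.
  by move=> l _; rewrite exprn_ge0.
by rewrite mem_index_enum => /(_ isT); rewrite /= sqrf_eq0 normr_eq0 => /eqP.
Qed.

Lemma adj_mul_eq0 m p (A : 'M[C]_(m, p)) : adj A *m A = 0 -> A = 0.
Proof. by move=> A0; apply: adj_mul_tr_eq0; rewrite A0 mxtrace0. Qed.

(* For [D = H - K] one has [H D = - D K], so the nonnegative traces of [D H D]
   and [D K D] cancel; hence [H D = K D = 0]. *)
Lemma psd_sqrt_uniq m p q (F : 'M[C]_(p, m)) (G : 'M[C]_(q, m)) :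
  let H := adj F *m F in let K := adj G *m G in
  H *m H = K *m K -> H = K.
Proof.
move=> H K HK; set D := H - K.
have aH : adj H = H by rewrite /H adjM adjK.
have aK : adj K = K by rewrite /K adjM adjK.
have aD : adj D = D by rewrite adjB aH aK.
have HDK : H *m D + D *m K = 0.
  by rewrite mulmxBr mulmxBl HK addrA subrK subrr.
have trs : \tr (adj (F *m D) *m (F *m D)) + \tr (adj (G *m D) *m (G *m D)) = 0.
  have -> : adj (F *m D) *m (F *m D) = D *m (H *m D) by rewrite adjM aD !mulmxA.
  have -> : adj (G *m D) *m (G *m D) = D *m (K *m D) by rewrite adjM aD !mulmxA.
  have -> : \tr (D *m (K *m D)) = \tr (D *m (D *m K)).
    by rewrite mulmxA mxtrace_mulC.
  by rewrite -mxtraceD -mulmxDr HDK mulmx0 mxtrace0.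
move/eqP: trs; rewrite paddr_eq0 ?adj_mul_tr_ge0 // => /andP[/eqP FD /eqP GD].
have {}FD := adj_mul_tr_eq0 FD; have {}GD := adj_mul_tr_eq0 GD.
have /(@adj_mul_eq0 m m)/eqP : adj D *m D = 0.
  by rewrite aD {1}/D mulmxBl -!mulmxA FD GD !mulmx0 subr0.
by rewrite subr_eq0 => /eqP.
Qed.

(** * Singular value decompositions and polar phases *)

Definition svd m p S (A : 'M[C]_(m, S)) (l : 'rV[C]_S) (B : 'M[C]_(p, S))
    (M : 'M[C]_(m, p)) :=
  [/\ adj A *m A = 1%:M, adj B *m B = 1%:M, (forall i, 0 < l 0 i)
    & M = A *m diag_mx l *m B^T].

(** Diagonalise [M *m adj M] by a unitary [P] and put [Q = P *m M]. The rows of [Q] are orthogonal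
    with squared norms the eigenvalues, so the nonzero rows, normalised, give [B], the roots of
    their eigenvalues give [l], and the matching columns of [adj P] give [A]. *)
Lemma svd_exists m p (M : 'M[C]_(m, p)) :
  exists S (A : 'M[C]_(m, S)) (l : 'rV[C]_S) (B : 'M[C]_(p, S)), svd A l B M.
Proof.
set G := M *m adj M.
have adjC (X : 'M[C]_m) : map_mx Num.conj X^T = adj X by rewrite /adj map_trmx.
have aG : adj G = G by rewrite adjM adjK.
have Gn : G \is normalmx.
  by apply/normalmxP; rewrite [map_mx _ _]adjC aG.
set P := spectralmx G; set D := spectral_diag G.
have Pu : P *m adj P = 1%:M.
  rewrite -adjC; apply/unitarymxP/spectral_unitarymx.
have Pu' : adj P *m P = 1%:M by apply: mulmx1C.
have GE : G = adj P *m diag_mx D *m P.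
  rewrite -adjC -invmx_unitary ?spectral_unitarymx //.
  exact/orthomx_spectralP.
set Q := P *m M.
have QQ : Q *m adj Q = diag_mx D.
  rewrite adjM mulmxA -[_ *m M *m adj M]mulmxA -/G GE.
  by rewrite !mulmxA Pu mul1mx -mulmxA Pu mulmx1.
have DE i : D 0 i = \sum_j `|Q i j| ^+ 2.
  have := congr1 (fun X : 'M_m => X i i) QQ.
  rewrite !mxE eqxx mulr1n => <-.
  by apply: eq_bigr => j _; rewrite adjE -normCK.
have D_ge0 i : 0 <= D 0 i.
  by rewrite DE sumr_ge0 // => j _; rewrite exprn_ge0.
(* Rows with eigenvalue zero vanish, so restricting to [T] loses nothing in the final product. *)
have Q0 i : D 0 i = 0 -> forall j, Q i j = 0.
  rewrite DE => /eqP; rewrite psumr_eq0 => [/allP Q0 j|j _]; last by rewrite exprn_ge0.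
  by have := Q0 j; rewrite mem_index_enum => /(_ isT); rewrite /= sqrf_eq0 normr_eq0 => /eqP.
pose T := [pred i | D 0 i != 0].
pose e (s : 'I_#|T|) : 'I_m := enum_val s.
have De s : 0 < D 0 (e s).
  by rewrite lt_def D_ge0 andbT; have := enum_valP s; rewrite inE.
pose l : 'rV[C]_#|T| := \row_s sqrtC (D 0 (e s)).
have l_gt0 s : 0 < l 0 s by rewrite mxE sqrtC_gt0.
have l_neq0 s : l 0 s != 0 by rewrite gt_eqF.
have lVR s : ((l 0 s)^-1)^* = (l 0 s)^-1 by apply/CrealP; rewrite gtr0_real ?invr_gt0.
exists #|T|, (\matrix_(i, s) (P (e s) i)^*), l, (\matrix_(j, s) (Q (e s) j / l 0 s)).
split=> //.
- apply/matrixP=> s t; rewrite [RHS]mxE mxE.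
  have := congr1 (fun X : 'M_m => X (e s) (e t)) Pu.
  rewrite !mxE (inj_eq enum_val_inj) => <-.
  by apply: eq_bigr => i _; rewrite !mxE conjCK.
- apply/matrixP=> s t; rewrite [RHS]mxE mxE.
  have QQst : \sum_j Q (e t) j * (Q (e s) j)^* = D 0 (e t) *+ (t == s).
    have := congr1 (fun X : 'M_m => X (e t) (e s)) QQ.
    rewrite [RHS]mxE (inj_eq enum_val_inj) mxE => <-.
    by apply: eq_bigr => j _; rewrite adjE.
  transitivity ((l 0 s)^-1 / l 0 t * (\sum_j Q (e t) j * (Q (e s) j)^*)).
    rewrite big_distrr; apply: eq_bigr => i _.
    rewrite adjE [(\matrix_(_, _) _) i s]mxE [(\matrix_(_, _) _) i t]mxE.
    by rewrite rmorphM /= lVR [RHS]mulrC mulrACA [_^* * Q _ _]mulrC.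
  rewrite QQst eq_sym; have [->|_] := eqVneq s t; last by rewrite mulr0n mulr0.
  have lE : D 0 (e t) = l 0 t * l 0 t by rewrite mxE -expr2 sqrtCK.
  by rewrite mulr1n lE mulrA divfK // mulVf.
- have -> : M = adj P *m Q by rewrite mulmxA Pu' mul1mx.
  apply/matrixP=> i j; rewrite mul_mx_diag mxE [RHS]mxE.
  under [RHS]eq_bigr => s _ do rewrite [X in X * _]mxE.
  rewrite (bigID T) /= [X in _ + X]big1 ?addr0; last first.
    by move=> s; rewrite negbK => /eqP /Q0 ->; rewrite mulr0.
  rewrite big_enum_val; apply: eq_bigr => s _; rewrite -/(e s).
  rewrite [(\matrix_(_, _) _) i s]mxE [_^T _ _]mxE [(\matrix_(_, _) _) j s]mxE.
  by rewrite adjE -mulrA [l 0 s * _]mulrC divfK.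
Qed.

(** The partial isometry of the polar decomposition. [B] is transposed and not conjugated because
    [M] will hold the coefficients of a vector in a tensor product, where both Schmidt bases enter
    linearly. *)
Definition is_polar m p (M U : 'M[C]_(m, p)) :=
  exists S (A : 'M[C]_(m, S)) (l : 'rV[C]_S) (B : 'M[C]_(p, S)),
    svd A l B M /\ U = A *m B^T.

Section Svd.
Variables (m p S : nat) (A : 'M[C]_(m, S)) (l : 'rV[C]_S) (B : 'M[C]_(p, S)).
Variable M : 'M[C]_(m, p).
Hypothesis AlB : svd A l B M.

Lemma svd_tr : svd B l A M^T.
Proof.
case: AlB => A1 B1 l0 ->; split=> //.
by rewrite !trmx_mul trmxK tr_diag_mx mulmxA.
Qed.

Lemma svd_tr_conj : B^T *m adj B^T = 1%:M.
Proof. by case: AlB => _ B1 _ _; rewrite adj_tr -trmx_mul B1 trmx1. Qed.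

Lemma svd_sqr : M *m adj M = A *m diag_mx l *m adj A *m (A *m diag_mx l *m adj A).
Proof.
have BB := svd_tr_conj; have [A1 _ l0 ->] := AlB.
by rewrite !adjM adj_diag // -!mulmxA [adj A *m _]mulmxA A1 mul1mx [B^T *m _]mulmxA BB mul1mx.
Qed.

(** The phase carries [adj E] to the complementary factor, and orthonormality of [B] then cancels
    [B] everywhere; what is left is the inner product in Schmidt coordinates. *)
Lemma svd_trace (W E : 'M[C]_m) :
  let U := (A *m B^T)^T in
  \tr (adj M *m W *m M *m (U *m (adj E)^T *m adj U)^T) =
  \tr (diag_mx l *m (adj A *m W *m A) *m diag_mx l *m adj (adj A *m E *m A)).
Proof.
move=> U; have BB := svd_tr_conj; have [A1 _ l0 ME] := AlB.
have UT : U^T = A *m B^T by rewrite trmxK.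
have -> : (U *m (adj E)^T *m adj U)^T = adj B^T *m adj A *m adj E *m (A *m B^T).
  by rewrite trmx_mul [(U *m _)^T]trmx_mul -(adj_tr U) UT adjM [(adj E)^T^T]trmxK !mulmxA.
rewrite ME 2!adjM adj_diag // [X in _ = \tr (_ *m X)]adjM [X in _ = \tr (_ *m (_ *m X))]adjM adjK.
rewrite -!(mulmxA (adj B^T)) mxtrace_mulC.
rewrite -!mulmxA (mulmxA _ (adj B^T)) BB mul1mx.
by rewrite mulmx1.
Qed.

Lemma svd_diag_unit : diag_mx l \in unitmx.
Proof.
case: AlB => _ _ l0 _; rewrite unitmxE det_diag unitfE.
by apply/prodf_neq0 => i _; rewrite gt_eqF.
Qed.

(** With [L] the diagonal matrix of [l], [M *m adj M] is [A L^2 adj A] and [L] is invertible, so the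
    image is the column span of [A]. *)
Lemma svd_proj : is_orth_proj (A *m adj A) (M *m adj M).
Proof.
have [A1 _ l0 ME] := AlB; split; last split.
- by rewrite mulmxA -[_ *m A]mulmxA A1 mulmx1.
- by rewrite adjM adjK.
rewrite svd_sqr; set X := diag_mx l.
have -> : A *m X *m adj A *m (A *m X *m adj A) = A *m (X *m X) *m adj A.
  by rewrite -!mulmxA [adj A *m (A *m _)]mulmxA A1 mul1mx.
have [Y XY] : exists Y, X *m Y = 1%:M by exists (invmx X); exact: mulmxV svd_diag_unit.
apply/andP; split; apply/submxP.
  (* The pseudo-inverse of [M *m adj M]. Images are compared as row spaces of transposes, hence the
     outer transpose. *)
  exists (A *m (Y *m Y) *m adj A)^T.
  rewrite -trmx_mul -!mulmxA [adj A *m (A *m _)]mulmxA A1 mul1mx.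
  by rewrite [X *m (Y *m _)]mulmxA XY mul1mx [X *m (Y *m _)]mulmxA XY mul1mx.
exists (A *m (X *m X) *m adj A)^T.
by rewrite -trmx_mul -!mulmxA [adj A *m (A *m _)]mulmxA A1 mul1mx.
Qed.

End Svd.

(** Equal images give [Q *m P = P] and [P *m Q = Q]; the adjoint of the first identity turns [P]
    into [P *m Q]. *)
Lemma orth_proj_uniq m (P Q G : 'M[C]_m) :
  is_orth_proj P G -> is_orth_proj Q G -> P = Q.
Proof.
move=> [PP [aP PG]] [QQ [aQ QG]].
have PQ : (P^T == Q^T)%MS.
  by apply/eqmxP; apply: eqmx_trans (eqmxP PG) (eqmx_sym (eqmxP QG)).
have QP : Q *m P = P.
  have /andP[/submxP[Z /(congr1 trmx) E] _] := PQ.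
  by move: E; rewrite trmx_mul !trmxK => ->; rewrite mulmxA QQ.
have PQ' : P *m Q = Q.
  have /andP[_ /submxP[Z /(congr1 trmx)]] := PQ.
  by rewrite trmx_mul !trmxK => ->; rewrite mulmxA PP.
by rewrite -aP -QP adjM aP aQ PQ'.
Qed.

(** Both sides are positive square roots of the same matrix; [sqrtE] writes them in the form
    [adj F *m F] to which [psd_sqrt_uniq] applies. *)
Lemma svd_sqrt_uniq m p q S S' (M : 'M[C]_(m, p)) (M' : 'M[C]_(m, q))
    (A : 'M_(m, S)) l (B : 'M_(p, S)) (A' : 'M_(m, S')) l' (B' : 'M_(q, S')) :
  svd A l B M -> svd A' l' B' M' -> M *m adj M = M' *m adj M' ->
  A *m diag_mx l *m adj A = A' *m diag_mx l' *m adj A'.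
Proof.
have sqrtE T r (X : 'M[C]_(r, T)) (k : 'rV[C]_T) : (forall i, 0 < k 0 i) ->
    X *m diag_mx k *m adj X =
    adj (diag_mx (map_mx sqrtC k) *m adj X) *m (diag_mx (map_mx sqrtC k) *m adj X).
  move=> k0; have k0' i : 0 < map_mx sqrtC k 0 i by rewrite mxE sqrtC_gt0.
  rewrite adjM adjK adj_diag // !mulmxA; congr (_ *m _); rewrite -mulmxA mulmx_diag.
  by congr (_ *m diag_mx _); apply/rowP=> i; rewrite !mxE -expr2 sqrtCK.
move=> s s' MM; have [_ _ l0 _] := s; have [_ _ l0' _] := s'.
rewrite (sqrtE _ _ A l l0) (sqrtE _ _ A' l' l0'); apply: psd_sqrt_uniq.
rewrite -(sqrtE _ _ A l l0) -(sqrtE _ _ A' l' l0').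
by rewrite -(svd_sqr s) -(svd_sqr s').
Qed.

(** The positive part [H = A L adj A] is common to both decompositions, and [H *m U = M = H *m V].
    Cancelling [A L] leaves [adj A *m U = adj A *m V], and both phases are fixed by the common
    projection [A *m adj A]. *)
Lemma polar_uniq m p (M U V : 'M[C]_(m, p)) : is_polar M U -> is_polar M V -> U = V.
Proof.
move=> [S [A [l [B [sU ->]]]]] [S' [A' [l' [B' [sV ->]]]]].
have HE := svd_sqrt_uniq sU sV erefl.
have PE := orth_proj_uniq (svd_proj sU) (svd_proj sV).
have [A1 _ l0 ME] := sU; have [A1' _ l0' ME'] := sV.
set H := A *m _ *m _ in HE.
have HU : H *m (A *m B^T) = M.
  by rewrite ME /H -!mulmxA [adj A *m _]mulmxA A1 mul1mx.
have HV : H *m (A' *m B'^T) = M.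
  by rewrite ME' HE -!mulmxA [adj A' *m _]mulmxA A1' mul1mx.
have : adj A *m (A *m B^T) = adj A *m (A' *m B'^T).
  apply: (can_inj (mulKmx (svd_diag_unit sU))).
  apply: (can_inj (f := mulmx A) (g := mulmx (adj A))) => [X|].
    by rewrite mulmxA A1 mul1mx.
  by rewrite !(mulmxA A) (mulmxA (A *m _)) -/H HU mulmxA HV.
move/(congr1 (mulmx A)); rewrite !mulmxA PE -PE -[A *m _ *m A]mulmxA A1 mulmx1 => ->.
by rewrite PE -[A' *m _ *m A']mulmxA A1' mulmx1.
Qed.

Lemma polar_exists m p (M : 'M[C]_(m, p)) : exists U, is_polar M U.
Proof.
have [S [A [l [B s]]]] := svd_exists M.
by exists (A *m B^T), S, A, l, B.
Qed.

Definition polar m p (M : 'M[C]_(m, p)) := epsilon (inhabits 0) (is_polar M).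

Lemma polarP m p (M : 'M[C]_(m, p)) : is_polar M (polar M).
Proof. by apply: epsilon_spec; apply: polar_exists. Qed.

Lemma polarE m p S (A : 'M[C]_(m, S)) l (B : 'M[C]_(p, S)) M :
  svd A l B M -> polar M = A *m B^T.
Proof. by move=> s; apply: polar_uniq (polarP M) _; exists S, A, l, B. Qed.

Lemma polar_tr m p (M : 'M[C]_(m, p)) : polar M^T = (polar M)^T.
Proof.
have [S [A [l [B [s ->]]]]] := polarP M.
by rewrite (polarE (svd_tr s)) trmx_mul trmxK.
Qed.

Lemma polar_proj m p (M : 'M[C]_(m, p)) :
  is_orth_proj (polar M *m adj (polar M)) (M *m adj M).
Proof.
have [S [A [l [B [s ->]]]]] := polarP M.
have := svd_proj s; rewrite adjM !mulmxA -(mulmxA A) (svd_tr_conj s) mulmx1.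
exact.
Qed.

Lemma polar_projK m p (M : 'M[C]_(m, p)) :
  polar M *m adj (polar M) *m polar M = polar M.
Proof.
have [S [A [l [B [s ->]]]]] := polarP M; have [A1 _ _ _] := s.
by rewrite adjM !mulmxA -(mulmxA A) (svd_tr_conj s) mulmx1 -(mulmxA A) A1 mulmx1.
Qed.

Lemma polar_projK_self m p (M : 'M[C]_(m, p)) :
  polar M *m adj (polar M) *m M = M.
Proof.
have [S [A [l [B [s ->]]]]] := polarP M; have [A1 _ _ ME] := s.
rewrite adjM !mulmxA -(mulmxA A) (svd_tr_conj s) mulmx1 {1}ME.
by rewrite !mulmxA -(mulmxA A) A1 mulmx1.
Qed.

(** [A] and [l] cancel on the outside, and the transpose of what remains is [adj B *m Z *m B = 0];
    the projection [U *m adj U] is [B *m adj B]. *)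
Lemma polar_nondeg m p (M : 'M[C]_(m, p)) (Z : 'M[C]_p) :
  M *m Z^T *m adj M = 0 ->
  let U := (polar M)^T in U *m adj U *m Z *m (U *m adj U) = 0.
Proof.
have [S [A [l [B [s ->]]]]] := polarP M; have [A1 _ l0 ->] := s.
set X := diag_mx l; have Xu : X \in unitmx := svd_diag_unit s.
have AT : A^T *m adj A^T = 1%:M by rewrite adj_tr -trmx_mul A1 trmx1.
move=> MZ /=; rewrite trmx_mul trmxK adjM !mulmxA -(mulmxA B) AT mulmx1.
have BZ : B^T *m Z^T *m adj B^T = 0.
  apply: (can_inj (mulKmx Xu)); apply: (can_inj (mulmxK Xu)).
  apply: (can_inj (f := mulmx A) (g := mulmx (adj A))) => [Y|].
    by rewrite mulmxA A1 mul1mx.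
  apply: (can_inj (f := mulmx^~ (adj A)) (g := mulmx^~ A)) => [Y|].
    by rewrite -mulmxA A1 mulmx1.
  rewrite mulmx0 mul0mx mulmx0 mul0mx -[RHS]MZ !adjM adj_diag //.
  by rewrite !mulmxA.
have {}BZ : adj B *m Z *m B = 0.
  by apply: trmx_inj; rewrite !trmx_mul mulmxA -adj_tr BZ trmx0.
by rewrite -!mulmxA (mulmxA (adj B)) (mulmxA _ B) BZ !(mul0mx, mulmx0).
Qed.

End Adjoint.

(** * Configurations, amplitude matrices and reduced densities *)

Section Bipartition.
Variable R : rcfType.
Local Notation C := (R[i]).
Variables (n : nat) (d : 'I_n -> nat).
Local Notation conf := 'I_(N d [set: 'I_n]).
Local Notation rstT J := (@rstT n d J).

Definition conf_at (i : 'I_n) (x : conf) : 'I_(d i) :=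
  (enum_val x : sidx d _) (exist _ i (in_setT i)).

Lemma restr_conf_at (J : {set 'I_n}) (x : conf) (i : sub J) :
  restr (subsetT J) (enum_val x) i = conf_at (val i) x.
Proof. by rewrite ffunE /conf_at; congr (enum_val x (exist _ _ _)); apply: bool_irrelevance. Qed.

Lemma rstT_eqP (J : {set 'I_n}) (x y : conf) :
  rstT J x = rstT J y <-> {in J, forall i, conf_at i x = conf_at i y}.
Proof.
split=> [/enum_rank_inj/ffunP xy i iJ|xy].
  by have := xy (exist _ i iJ); rewrite !restr_conf_at.
congr enum_rank; apply/ffunP=> i; rewrite !restr_conf_at; apply: xy.
exact: valP.
Qed.

Lemma conf_inj (J : {set 'I_n}) (x y : conf) :
  rstT J x = rstT J y -> rstT (~: J) x = rstT (~: J) y -> x = y.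
Proof.
move=> /rstT_eqP xy /rstT_eqP xy'; apply: enum_val_inj; apply/ffunP => -[i iT].
have <- : in_setT i = iT by apply: bool_irrelevance.
by have [iJ|iJ] := boolP (i \in J); [apply: xy | apply: xy'; rewrite inE].
Qed.

Lemma conf_glue (J : {set 'I_n}) (a : 'I_(N d J)) (b : 'I_(N d (~: J))) :
  exists x : conf, rstT J x = a /\ rstT (~: J) x = b.
Proof.
have inC i (iJ : (i \in J) = false) : i \in ~: J by rewrite inE iJ.
(* The match returns a function of the membership proof, since [a] and [b] can only be evaluated at
   an index together with such a proof. *)
pose g (i : 'I_n) : 'I_(d i) :=
  (if i \in J as c return (i \in J) = c -> 'I_(d i)
   then fun iJ => (enum_val a : sidx d _) (exist _ i iJ)
   else fun iJ => (enum_val b : sidx d _) (exist _ i (inC i iJ))) erefl.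
have gJ i (iJ : i \in J) : g i = (enum_val a : sidx d _) (exist _ i iJ).
  rewrite /g; move: (erefl (i \in J)); rewrite {2 3}iJ => iJ'.
  by congr (enum_val a (exist _ _ _)); apply: bool_irrelevance.
have gC i (iJ : i \in ~: J) : g i = (enum_val b : sidx d _) (exist _ i iJ).
  rewrite /g; move: (erefl (i \in J)); have iJ2 := iJ.
  rewrite inE in iJ2; rewrite {2 3}(negbTE iJ2) => iJ'.
  by congr (enum_val b (exist _ _ _)); apply: bool_irrelevance.
exists (enum_rank ([ffun i : sub [set: 'I_n] => g (val i)] : sidx d _)).
split; rewrite /Defs.rstT /rst enum_rankK -[RHS]enum_valK; congr enum_rank;
  apply/ffunP => -[i iJ]; rewrite ffunE ffunE; [exact: gJ | exact: gC].
Qed.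

Variable psi : vec R d [set: 'I_n].

(** For [K = ~: I] this is [M_I], each entry being a single amplitude. Leaving [K] free avoids casts
    between [I] and [~: (~: I)], as in [amp_tr]. *)
Definition amp (I K : {set 'I_n}) : 'M[C]_(N d I, N d K) :=
  \matrix_(a, b) \sum_(x : conf | (rstT I x == a) && (rstT K x == b)) psi x 0.

Lemma amp_tr (I K : {set 'I_n}) : (amp I K)^T = amp K I.
Proof. by apply/matrixP=> a b; rewrite !mxE; apply: eq_bigl => x; rewrite andbC. Qed.

Lemma ampE (I : {set 'I_n}) (x : conf) :
  amp I (~: I) (rstT I x) (rstT (~: I) x) = psi x 0.
Proof.
rewrite mxE (bigD1 x) ?eqxx //= big1 ?addr0 // => y /andP[/andP[/eqP yx /eqP yx']].
by rewrite (conf_inj yx yx') eqxx.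
Qed.

Lemma rhoE (I : {set 'I_n}) : rho psi I = amp I (~: I) *m adj (amp I (~: I)).
Proof.
apply/matrixP => a a'; rewrite !mxE.
under [RHS]eq_bigr => b _.
  rewrite adjE !mxE rmorph_sum big_distrl.
  under eq_bigr => x _ do rewrite big_distrr.
  over.
rewrite /= [RHS](exchange_big_dep (fun x => rstT I x == a)) /=; last by move=> b x _ /andP[].
apply: eq_bigr => x xa; rewrite (big_pred1 (rstT (~: I) x)) /=; last first.
  by move=> b; rewrite xa eq_sym.
by apply: eq_bigl => y; rewrite [rstT (~: I) y == _]eq_sym.
Qed.

Definition phase (I K : {set 'I_n}) : 'M[C]_(N d I, N d K) := polar (amp I K).

Lemma phase_tr (I K : {set 'I_n}) : (phase I K)^T = phase K I.
Proof. by rewrite /phase -amp_tr polar_tr trmxK. Qed.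

(** [supp_proj] is chosen by [epsilon]; uniqueness of orthogonal projections identifies the
    choice. *)
Lemma supp_projE (I : {set 'I_n}) :
  supp_proj psi I = phase I (~: I) *m adj (phase I (~: I)).
Proof.
have orthP : is_orth_proj (phase I (~: I) *m adj (phase I (~: I))) (rho psi I).
  rewrite rhoE; exact: polar_proj.
apply: (orth_proj_uniq _ orthP).
apply: (epsilon_spec (inhabits 0) (fun P => is_orth_proj P (rho psi I))).
by exists (phase I (~: I) *m adj (phase I (~: I))); exact: orthP.
Qed.

(** * Schmidt data as singular value decompositions *)

Section SchmidtBases.
Variables (I : {set 'I_n}) (s : Defs.schmidt R d I).
Definition schmidtA : 'M[C]_(N d I, sS s) := \matrix_(a, al) sa al a 0.
Definition schmidtB : 'M[C]_(N d (~: I), sS s) := \matrix_(b, al) sb al b 0.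
Definition schmidtl : 'rV[C]_(sS s) := \row_al slam al.

Lemma schmidt_gram (m p : nat) (v : 'I_p -> 'cV[C]_m) al be :
  (adj (\matrix_(a, al) v al a 0) *m (\matrix_(a, al) v al a 0)) al be =
  (adj (v al) *m v be) 0 0.
Proof. by rewrite !mxE; apply: eq_bigr => a _; rewrite !mxE. Qed.

(** Gluing configurations shows that every entry of [amp] is an amplitude of [psi], so a Schmidt
    expansion is a matrix factorisation. [schm_svd] uses one direction to produce Schmidt data and
    the other to read off the chosen ones. *)
Lemma is_schmidtP :
  is_schmidt psi s <-> svd schmidtA schmidtl schmidtB (amp I (~: I)).
Proof.
have prodE a b : (schmidtA *m diag_mx schmidtl *m schmidtB^T) a b =
    \sum_(al < sS s) slam al * sa al a 0 * sb al b 0.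
  rewrite mul_mx_diag [LHS]mxE; apply: eq_bigr => al _.
  by rewrite !mxE [sa al a 0 * _]mulrC.
split=> [[l0 [sA [sB psiE]]]|[sA sB l0 ME]].
  split; first by apply/matrixP=> al be; rewrite schmidt_gram sA mxE.
  - by apply/matrixP=> al be; rewrite schmidt_gram sB mxE.
  - by move=> al; rewrite mxE.
  apply/matrixP=> a b; rewrite prodE; have [x [<- <-]] := conf_glue a b.
  by rewrite ampE psiE.
split; first by move=> al; have := l0 al; rewrite mxE.
split.
  move=> al be; have := congr1 (fun X : 'M_(sS s) => X al be) sA.
  by rewrite schmidt_gram => ->; rewrite mxE.
split.
  move=> al be; have := congr1 (fun X : 'M_(sS s) => X al be) sB.
  by rewrite schmidt_gram => ->; rewrite mxE.
by move=> x; rewrite -(ampE I) ME prodE.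
Qed.

End SchmidtBases.

Lemma schm_svd (I : {set 'I_n}) :
  svd (schmidtA (schm psi I)) (schmidtl (schm psi I)) (schmidtB (schm psi I))
    (amp I (~: I)).
Proof.
apply/is_schmidtP; apply: epsilon_spec.
have [S [A [l [B AlB]]]] := svd_exists (amp I (~: I)).
exists (@Schmidt R n d I S (fun al => l 0 al) (fun al => col al A) (fun al => col al B)).
apply/is_schmidtP; rewrite /schmidtA /schmidtB /schmidtl /=.
have -> : (\matrix_(a, al) (col al A) a 0) = A by apply/matrixP=> a al; rewrite !mxE.
have -> : (\matrix_(a, al) (col al B) a 0) = B by apply/matrixP=> a al; rewrite !mxE.
by have -> : \row_al l 0 al = l by apply/rowP=> al; rewrite !mxE.
Qed.

(** * The bilinear pairing defined by [psi] *)

Definition pairing (I K : {set 'I_n}) (X : op R d I) (Y : op R d K) : C :=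
  \sum_(x : conf) \sum_(y : conf)
    (psi x 0)^* * psi y 0 * (X (rstT I x) (rstT I y) * Y (rstT K x) (rstT K y)).

(** Grouping the two configurations by their restrictions to [K] and then to [I] collects the
    amplitudes into entries of [amp]. *)
Lemma pairingE (I K : {set 'I_n}) (X : op R d I) (Y : op R d K) :
  pairing X Y = \tr (adj (amp I K) *m X *m amp I K *m Y^T).
Proof.
have -> : \tr (adj (amp I K) *m X *m amp I K *m Y^T) =
    \sum_b \sum_b' \sum_a \sum_a'
      (amp I K a b)^* * amp I K a' b' * (X a a' * Y b b').
  apply: eq_bigr => b _; rewrite mxE; apply: eq_bigr => b' _.
  rewrite -mulmxA mxE big_distrl; apply: eq_bigr => a _.
  rewrite [(X *m _) _ _]mxE !big_distrr /= big_distrl; apply: eq_bigr => a' _.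
  rewrite adjE [Y^T _ _]mxE /= !mulrA; congr (_ * _).
  by rewrite -!mulrA; congr (_ * _); rewrite mulrC.
under [RHS]eq_bigr => b _ do under eq_bigr => b' _ do under eq_bigr => a _
  do under eq_bigr => a' _ do rewrite !mxE rmorph_sum !big_distrl.
rewrite /pairing (partition_big (rstT K) xpredT) //=; apply: eq_bigr => b _.
rewrite exchange_big (partition_big (rstT K) xpredT) //=; apply: eq_bigr => b' _.
rewrite exchange_big (partition_big (rstT I) xpredT) //=; apply: eq_bigr => a _.
rewrite exchange_big (partition_big (rstT I) xpredT) //=; apply: eq_bigr => a' _.
rewrite exchange_big; apply: eq_big => [x|x /andP[/eqP <- /eqP <-]].
  by rewrite andbC.
rewrite big_distrr big_distrl; apply: eq_big => [y|y /andP[/eqP <- /eqP <-]] //.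
by rewrite andbC.
Qed.

End Bipartition.

(** * Inversions and signs of shuffles *)

Section ShuffleSign.
Variable n : nat.
Implicit Types I J : {set 'I_n}.

Definition ninv J := (\sum_(i in J) \sum_(l in ~: J) (l < i))%N.

(** Each pair with one element in [J] and one outside is an inversion for exactly one of [J] and
    [~: J]. *)
Lemma ninvC J : (ninv J + ninv (~: J) = #|J| * (n - #|J|))%N.
Proof.
rewrite /ninv setCK [X in (_ + X)%N]exchange_big -big_split /=.
rewrite -sum_nat_const; apply: eq_bigr => i iJ.
have -> : (n - #|J| = #|~: J|)%N by rewrite [in RHS]cardsCs setCK card_ord.
rewrite -big_split -sum1_card; apply: eq_bigr => l; rewrite inE => lJ /=.
have : l != i by apply: contraNneq lJ => ->.
by rewrite -val_eqE /=; case: ltngtP.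
Qed.

Lemma card_ltE J (j : 'I_n) : #|[set i in J | (i < j)%N]| = (\sum_(i in J) (i < j))%N.
Proof.
rewrite -sum1_card [RHS](eq_bigr (fun i : 'I_n => if (i < j)%N then 1 else 0)%N); last first.
  by move=> i _; case: (i < j)%N.
by rewrite -big_mkcondr; apply: eq_bigl => i; rewrite inE.
Qed.

(** Moving [j] into [J] creates inversions with the smaller elements outside and destroys those with
    the larger elements of [J]. The terms are arranged to avoid subtraction, and the even term
    disappears from signs. *)
Lemma ninvU1 J j : j \notin J ->
  (ninv (j |: J) + #|[set i in J | (i < j)%N]| + 2 * \sum_(i in J) (j < i) =
   ninv J + #|[set l in ~: J :\ j | (l < j)%N]| + #|J|)%N.
Proof.
move=> jJ; rewrite !card_ltE.
have -> : #|J| = (\sum_(i in J) (i < j) + \sum_(i in J) (j < i))%N.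
  rewrite -big_split -sum1_card; apply: eq_bigr => i iJ /=.
  have : i != j by apply: contraNneq jJ => <-.
  by rewrite -val_eqE /=; case: ltngtP.
have CE : ~: (j |: J) = ~: J :\ j by rewrite setCU setDE setIC.
have jC : j \in ~: J by rewrite inE.
have -> : ninv J = (\sum_(i in J) (j < i) + \sum_(i in J) \sum_(l in ~: J :\ j) (l < i))%N.
  by rewrite -big_split; apply: eq_bigr => i iJ; rewrite (big_setD1 j).
rewrite /ninv big_setU1 //= CE.
by rewrite mul2n -addnn [RHS](AC (3*2)%AC ((3*2*4)*(1*5))%AC).
Qed.

Definition shsign (R : pzRingType) J : R := (-1) ^+ ninv J.

End ShuffleSign.

(** * The pairing and the support projections *)

Section EntanglementForms.
Variable R : rcfType.
Local Notation C := (R[i]).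
Variables (n : nat) (d : 'I_n -> nat) (psi : vec R d [set: 'I_n]).
Local Notation conf := 'I_(N d [set: 'I_n]).
Local Notation rstT J := (@rstT n d J).
Local Notation eform := (eform R d).
Implicit Types (I J K : {set 'I_n}) (w e : eform).
Local Notation pairing := (pairing psi).
Local Notation supp := (supp_proj psi).
Local Notation phase := (phase psi).
Local Notation eps := (shsign C).

Lemma pairingC I K (X : op R d I) (Y : op R d K) : pairing X Y = pairing Y X.
Proof. by apply: eq_bigr => x _; apply: eq_bigr => y _; rewrite (mulrC (X _ _)). Qed.

Lemma pairingDl I K (X X' : op R d I) (Y : op R d K) :
  pairing (X + X') Y = pairing X Y + pairing X' Y.
Proof.
rewrite -big_split; apply: eq_bigr => x _; rewrite -big_split; apply: eq_bigr => y _.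
by rewrite mxE mulrDl mulrDr.
Qed.

Lemma pairingZl I K a (X : op R d I) (Y : op R d K) :
  pairing (a *: X) Y = a * pairing X Y.
Proof.
rewrite big_distrr; apply: eq_bigr => x _; rewrite big_distrr; apply: eq_bigr => y _.
by rewrite /= mxE -(mulrA a) mulrCA.
Qed.

Lemma pairing_suml I K (T : finType) (F : T -> op R d I) (Y : op R d K) :
  pairing (\sum_t F t) Y = \sum_t pairing (F t) Y.
Proof.
have pairing0 : pairing (0 : op R d I) Y = 0.
  by rewrite -(scale0r (0 : op R d I)) pairingZl mul0r.
exact: (big_morph (fun X : op R d I => pairing X Y) (fun X X' => pairingDl X X' Y) pairing0).
Qed.

Lemma phase_projK I K : phase I K *m adj (phase I K) *m phase I K = phase I K.
Proof. exact: polar_projK. Qed.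

Lemma phase_projK_amp I K : phase I K *m adj (phase I K) *m amp psi I K = amp psi I K.
Proof. exact: polar_projK_self. Qed.

Lemma supp_projCE I K : K = ~: I -> supp I = phase I K *m adj (phase I K).
Proof. by move=> ->; apply: supp_projE. Qed.

Lemma adj_supp I : adj (supp I) = supp I.
Proof. by rewrite supp_projE adjM adjK. Qed.

Lemma supp_idem I : supp I *m supp I = supp I.
Proof. by rewrite supp_projE mulmxA phase_projK. Qed.

(** [supp I] fixes the columns of [amp], so the pairing cannot see the truncation. *)
Lemma pairing_suppl I K (X : op R d I) (Y : op R d K) : K = ~: I ->
  pairing (supp I *m X *m supp I) Y = pairing X Y.
Proof.
move=> KI; have sA : supp I *m amp psi I K = amp psi I K.
  by rewrite (supp_projCE KI) phase_projK_amp.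
rewrite !pairingE -!mulmxA (mulmxA (supp I) (amp psi I K)) sA.
by rewrite (mulmxA _ (supp I)) -{1}adj_supp -adjM sA.
Qed.

Lemma pairing_suppr I K (X : op R d I) (Y : op R d K) : K = ~: I ->
  pairing X (supp K *m Y *m supp K) = pairing X Y.
Proof. by move=> KI; rewrite pairingC pairing_suppl 1?pairingC // KI setCK. Qed.

Lemma pairing_nondeg I K (Z : op R d K) : K = ~: I ->
  (forall X : op R d I, pairing (supp I *m X *m supp I) Z = 0) ->
  supp K *m Z *m supp K = 0.
Proof.
move=> KI Z0; have IK : I = ~: K by rewrite KI setCK.
set M := amp psi I K.
have : M *m Z^T *m adj M = 0.
  (* Testing against the adjoint of [M *m Z^T *m adj M] makes the pairing the squared Frobenius norm
     of that matrix. *)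
  apply: adj_mul_tr_eq0; rewrite mulmxA mxtrace_mulC -[RHS](Z0 (adj (M *m Z^T *m adj M))).
  by rewrite pairing_suppl // pairingE -/M -!mulmxA.
rewrite (supp_projCE IK) -phase_tr; apply: polar_nondeg.
Qed.

(** * Componentwise adjoints and the star operator *)

Definition adjf w : eform := fun I => adj (w I).

Lemma adjfZ a w : adjf (eformZ a w) = eformZ a^* (adjf w).
Proof.
by apply: functional_extensionality_dep => I; rewrite /adjf /eformZ adj_scale.
Qed.

Lemma adjfK w : adjf (adjf w) = w.
Proof. by apply: functional_extensionality_dep => I; rewrite /adjf adjK. Qed.

(** This is the formula for [(star w)_(~: I)] read at [I = ~: J]: the sign belongs to the source
    index, and [phase J (~: J)] is the transpose of [U_I]. *)
Definition star w : eform := fun J =>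
  eps (~: J) *: (phase J (~: J) *m (w (~: J))^T *m adj (phase J (~: J))).

Lemma starE w J K : J = ~: K ->
  star w J = eps K *: (phase J K *m (w K)^T *m adj (phase J K)).
Proof. by move=> JK; have -> : K = ~: J by rewrite JK setCK. Qed.

Lemma phase_supp I K : K = ~: I -> supp I *m phase I K = phase I K.
Proof. by move=> KI; rewrite (supp_projCE KI) phase_projK. Qed.

Lemma form_phase k w I : isForm psi k w ->
  supp I *m w I *m supp I = w I.
Proof.
move=> [wI w0]; have [cI|/eqP cI] := eqVneq #|I| k; first by rewrite -wI.
by rewrite w0 // mulmx0 mul0mx.
Qed.

Lemma star_form k w : isForm psi k w -> isForm psi (n - k) (star w).
Proof.
move=> wF; split=> [I cI|I cI].
  rewrite /star -scalemxAr -scalemxAl; congr (_ *: _).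
  rewrite !mulmxA phase_supp // -!mulmxA.
  by rewrite -{1}adj_supp -adjM phase_supp.
rewrite /star (proj2 wF) ?trmx0 ?mulmx0 ?mul0mx ?scaler0 // => cI'.
by apply: cI; rewrite -cI' [LHS]cardsCs card_ord.
Qed.

(** The transposes cancel, the phases compose to [supp I] on each side, which fixes a form, and the
    product of the two shuffle signs is given by [ninvC]. *)
Lemma starK k w : (k <= n)%N -> isForm psi k w ->
  star (star w) = eformZ ((-1) ^+ (k * (n - k))) w.
Proof.
move=> kn wF; apply: functional_extensionality_dep => I.
rewrite /eformZ.
have [cI|/eqP cI] := eqVneq #|I| k; last first.
  have [_ ->] := star_form (star_form wF); last by rewrite subKn.
  by rewrite (proj2 wF) ?scaler0.
rewrite {1}/star (starE w (erefl (~: I))).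
rewrite linearZ /= -scalemxAr -scalemxAl scalerA.
rewrite mulrC /shsign -exprD ninvC cI; congr (_ *: _).
rewrite -[RHS](form_phase I wF) supp_projE.
rewrite -(phase_tr psi I (~: I)) !trmx_mul adj_tr !trmxK.
by rewrite !mulmxA.
Qed.

(** * The coboundary before truncation and scaling, and its transpose *)

Definition rawd w : eform := fun I => \sum_(j : sub I) tensId (w (I :\ val j)).

Lemma rawdZ a w : rawd (eformZ a w) = eformZ a (rawd w).
Proof.
apply: functional_extensionality_dep => I; rewrite /rawd /eformZ scaler_sumr.
apply: eq_bigr => j _; rewrite /tensId scalerA mulrC -scalerA; congr (_ *: _).
by apply/matrixP=> u v; rewrite !mxE mulrCA.
Qed.

Lemma rawd_adj w : rawd (adjf w) = adjf (rawd w).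
Proof.
apply: functional_extensionality_dep => I; rewrite /rawd /adjf adj_sum.
apply: eq_bigr => j _; rewrite /tensId adj_scale rmorphXn rmorphN rmorph1; congr (_ *: _).
by apply/matrixP=> u v; rewrite !mxE rmorphM rmorph_nat eq_sym.
Qed.

(** The pairing of [tensId X] with [Y] up to sign, the identity sitting on factor [j]. Its symmetry
    in [X] and [Y] lets that identity be attached to either side. *)
Definition contr (J K : {set 'I_n}) (j : 'I_n) (X : op R d J) (Y : op R d K) : C :=
  \sum_(x : conf) \sum_(y : conf) (psi x 0)^* * psi y 0 *
    ((conf_at j x == conf_at j y)%:R * X (rstT J x) (rstT J y) * Y (rstT K x) (rstT K y)).

Lemma contrC J K j (X : op R d J) (Y : op R d K) : contr j X Y = contr j Y X.
Proof.
by apply: eq_bigr => x _; apply: eq_bigr => y _; rewrite -!mulrA (mulrC (X _ _)).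
Qed.

Lemma rst_rstT I J (JI : J \subset I) (x : conf) : rst JI (rstT I x) = rstT J x.
Proof.
rewrite /Defs.rstT /rst enum_rankK; congr enum_rank; apply/ffunP => i.
rewrite ffunE (restr_conf_at x (exist _ (val i) (subsetP JI _ (valP i)))).
by rewrite restr_conf_at.
Qed.

Lemma pairing_tensId I K (j : sub I) (X : op R d (I :\ val j)) (Y : op R d K) :
  pairing (tensId X) Y =
  (-1) ^+ #|[set i in I :\ val j | (i < val j)%N]| * contr (val j) X Y.
Proof.
rewrite /tensId pairingZl; congr (_ * _).
apply: eq_bigr => x _; apply: eq_bigr => y _; congr (_ * (_ * _)).
rewrite mxE !rst_rstT /Defs.rstT /rst !enum_rankK.
by rewrite !restr_conf_at.
Qed.

Lemma pairing_rawd I K w (Y : op R d K) :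
  pairing (rawd w I) Y = \sum_(j in I)
    (-1) ^+ #|[set i in I :\ j | (i < j)%N]| * contr j (w (I :\ j)) Y.
Proof.
rewrite pairing_suml (big_sub (I := 'I_n) (mem I)
  (fun j => (-1) ^+ #|[set i in I :\ j | (i < j)%N]| * contr j (w (I :\ j)) Y)).
by apply: eq_bigr => j _; rewrite pairing_tensId.
Qed.

Definition fpairing (k : nat) w e : C :=
  \sum_(I : {set 'I_n} | #|I| == k) eps I * pairing (w I) (e (~: I)).

(** Both sides expand over pairs [(J, j)] with [j] outside [J] into the same contractions, the
    identity at [j] moving from [w] to [e]; the signs agree by [ninvU1]. *)
Lemma fpairing_rawd k w e :
  fpairing k.+1 (rawd w) e = (-1) ^+ k * fpairing k w (rawd e).
Proof.
pose F (p : {set 'I_n} * 'I_n) : C := eps (p.2 |: p.1) *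
  ((-1) ^+ #|[set i in p.1 | (i < p.2)%N]| *
   contr p.2 (w p.1) (e (~: (p.2 |: p.1)))).
transitivity (\sum_(p : {set 'I_n} * 'I_n | (#|p.1| == k) && (p.2 \notin p.1)) F p).
  rewrite /fpairing.
  under eq_bigr => I _ do rewrite pairing_rawd big_distrr.
  rewrite pair_big_dep /=.
  (* Substitute [I = j |: J]. *)
  rewrite (reindex_onto (fun p : {set 'I_n} * 'I_n => (p.2 |: p.1, p.2))
    (fun p => (p.1 :\ p.2, p.2))) /=; last first.
    by move=> [I j] /= /andP[_ jI]; rewrite setD1K.
  apply: eq_big => [[J j]|[J j]] /=.
    rewrite setU11 andbT xpair_eqE eqxx andbT; have [jJ|jJ] := boolP (j \in J).
      rewrite andbF; apply/negP => /andP[_ /eqP/setP/(_ j)].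
      by rewrite !inE eqxx jJ.
    by rewrite setU1K // eqxx !andbT cardsU1 jJ eqSS.
  by rewrite xpair_eqE => /andP[_ /andP[/eqP -> _]].
rewrite /fpairing big_distrr.
under [RHS]eq_bigr => J _ do rewrite pairingC pairing_rawd !big_distrr.
rewrite pair_big_dep; apply: eq_big => [[J j]|[J j]] /=; first by rewrite inE.
move=> /andP[/eqP cJ jJ]; rewrite /F /= contrC.
have -> : ~: J :\ j = ~: (j |: J) by rewrite setCU setDE setIC.
rewrite !mulrA; congr (_ * _); rewrite /shsign -!exprD -cJ.
have := congr1 (fun m => (-1) ^+ m : C) (ninvU1 jJ).
rewrite exprD exprM sqrrN expr1n expr1n mulr1.
have -> : ~: J :\ j = ~: (j |: J) by rewrite setCU setDE setIC.
by move=> ->; congr (_ ^+ _); rewrite addnC !addnA.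
Qed.

Lemma shsign_sqr I : eps I * eps I = 1.
Proof. by rewrite -expr2 sqrr_sign. Qed.

Lemma formZ k a w : isForm psi k w -> isForm psi k (eformZ a w).
Proof.
move=> [wI w0]; split=> I cI; rewrite /eformZ.
  by rewrite -scalemxAr -scalemxAl -wI.
by rewrite w0 // scaler0.
Qed.

Lemma form_adj k w : isForm psi k w -> isForm psi k (adjf w).
Proof.
move=> [wI w0]; split=> I cI; rewrite /adjf.
  by rewrite {1}wI // !adjM adj_supp mulmxA.
by apply/matrixP=> a b; rewrite adjE w0 // !mxE rmorph0.
Qed.

Lemma starZ a w : star (eformZ a w) = eformZ a (star w).
Proof.
apply: functional_extensionality_dep => I; rewrite /star /eformZ.
by rewrite linearZ /= -scalemxAr -scalemxAl !scalerA mulrC.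
Qed.

Lemma starD w e : star (eformD w e) = eformD (star w) (star e).
Proof.
apply: functional_extensionality_dep => I; rewrite /star /eformD.
by rewrite linearD /= mulmxDr mulmxDl scalerDr.
Qed.

Lemma star_adj w : star (adjf w) = adjf (star w).
Proof.
apply: functional_extensionality_dep => I; rewrite /star /adjf adj_scale.
rewrite rmorphXn rmorphN rmorph1; congr (_ *: _).
rewrite [in RHS]adjM [in RHS]adjM adjK adj_tr !mulmxA //.
Qed.

Lemma eformZZ a b w : eformZ a (eformZ b w) = eformZ (a * b) w.
Proof. by apply: functional_extensionality_dep => I; rewrite /eformZ scalerA. Qed.

Lemma eformZ_eq0 a w : a != 0 -> eformZ a w = eform0 R d -> w = eform0 R d.
Proof.
move=> a0 aw; apply: functional_extensionality_dep => I.
have /eqP := congr1 (fun f : eform => f I) aw.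
by rewrite /eformZ scaler_eq0 (negbTE a0) => /eqP.
Qed.

(** * The truncated coboundary and nondegeneracy of the pairing of forms *)

Definition projd (p : nat) w : eform := fun I =>
  if #|I| == p then supp I *m rawd w I *m supp I else 0.

Lemma projd_form p w : isForm psi p (projd p w).
Proof.
split=> I cI; rewrite /projd; last by case: eqP.
rewrite cI eqxx; rewrite !mulmxA supp_idem -!mulmxA.
by rewrite !(mulmxA _ _ (supp I)) -(mulmxA _ (supp I) (supp I)) supp_idem.
Qed.

Lemma projdZ p a w : projd p (eformZ a w) = eformZ a (projd p w).
Proof.
apply: functional_extensionality_dep => I; rewrite /projd rawdZ /eformZ.
by case: eqP => _; rewrite ?scaler0 // -scalemxAr -scalemxAl.
Qed.

Lemma projd_adj p w : projd p (adjf w) = adjf (projd p w).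
Proof.
apply: functional_extensionality_dep => I; rewrite /projd rawd_adj /adjf.
case: eqP => _; first by rewrite !adjM adj_supp mulmxA.
by apply/matrixP=> a b; rewrite adjE !mxE rmorph0.
Qed.

Lemma N_set0 : N d (set0 : {set 'I_n}) = 1%N.
Proof.
apply/eqP; rewrite eqn_leq; apply/andP; split.
  by apply/fintype_le1P => f g; apply/ffunP => -[x xP]; have := xP; rewrite inE.
have H (i : sub (set0 : {set 'I_n})) : False by case: i => i; rewrite inE.
apply/card_gt0P.
by exists ([ffun i : sub set0 => match H i with end] : sidx d set0).
Qed.

Lemma ord_set0 J (a b : 'I_(N d J)) : J = set0 -> a = b.
Proof.
move=> J0; have : (#|'I_(N d J)| <= 1)%N by rewrite card_ord J0 N_set0.
by move/fintype_le1P; apply.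
Qed.

Lemma mx1_mxtrace m (X : 'M[C]_m) : m = 1%N -> X = (\tr X)%:M.
Proof. by move=> m1; move: X; rewrite m1 => X; rewrite {1}[X]mx11_scalar /mxtrace big_ord1. Qed.

Lemma mx1_mxtrace_mul_adj m (X Y : 'M[C]_m) : m = 1%N ->
  \tr (X *m adj Y) = \tr X * (\tr Y)^*.
Proof.
move=> m1; move: X Y; rewrite m1 => X Y.
by rewrite /mxtrace !big_ord1 mxE big_ord1 adjE.
Qed.

(** On a singleton the sign exponent counts an empty set and [w set0] is a scalar, so the general
    formula also covers the separately defined [d^0]. *)
Lemma rawd_card1 I w : #|I| = 1%N -> rawd w I = (\tr (w set0))%:M.
Proof.
move=> cI; have I0 (j : sub I) : I :\ val j = set0.
  by apply/eqP; rewrite -cards_eq0 -eqSS -[X in _ == X]cI (cardsD1 (val j) I) (valP j).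
have tE (j : sub I) : tensId (w (I :\ val j)) = (\tr (w set0))%:M.
  rewrite /tensId.
  have -> : #|[set i in I :\ val j | (i < val j)%N]| = 0%N.
    by apply/eqP; rewrite cards_eq0; apply/eqP/setP=> i; rewrite I0 !inE.
  rewrite scale1r; apply/matrixP=> u v; rewrite mxE.
  rewrite [w _]mx1_mxtrace; last by rewrite I0 N_set0.
  rewrite mxE (ord_set0 (rst (subD1set I (val j)) u) (rst (subD1set I (val j)) v) (I0 j)).
  rewrite eqxx mulr1n I0 mxE.
  suff -> : ((enum_val u : sidx d I) j == (enum_val v : sidx d I) j) = (u == v).
    by rewrite mulr_natl.
  apply/eqP/eqP => [uv|->//]; apply: enum_val_inj; apply/ffunP => i.
  suff -> : i = j by [].
  apply: val_inj; have /card_le1_eqP : (#|I| <= 1)%N by rewrite cI.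
  by apply; apply: valP.
rewrite /rawd (eq_bigr _ (fun j _ => tE j)) sumr_const.
have -> : #|{: sub I}| = 1%N by rewrite -cI card_sig; apply: eq_card => i; rewrite !inE.
by rewrite mulr1n.
Qed.

(** [maxn] merges the factor [m] of [d^m] with the factor 1 of [d^0]. *)
Definition dcoef (m : nat) : C := (maxn m 1)%:R.

Lemma dcoef_neq0 m : dcoef m != 0.
Proof. by rewrite pnatr_eq0 -lt0n leq_max orbT. Qed.

Lemma dformE m w : dform psi m w = eformZ (dcoef m) (projd m.+1 w).
Proof.
apply: functional_extensionality_dep => I; rewrite /dform /eformZ /projd /dcoef.
case: m => [|m] /=; case: eqP => cI; rewrite ?scaler0 ?scale1r //.
  by rewrite rawd_card1 // mul_mx_scalar -scalemxAl supp_idem.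
by rewrite -scalemxAr -scalemxAl (maxn_idPl _).
Qed.

Lemma fpairingZr k a w e : fpairing k w (eformZ a e) = a * fpairing k w e.
Proof.
rewrite big_distrr; apply: eq_bigr => I _ /=.
by rewrite pairingC pairingZl pairingC mulrCA.
Qed.

(** Both truncations are invisible to the pairing, so [fpairing_rawd] passes to the truncated
    coboundaries. *)
Lemma fpairing_dform m w e :
  fpairing m.+1 (dform psi m w) e =
  dcoef m * (-1) ^+ m * fpairing m w (projd (n - m) e).
Proof.
rewrite -mulrA; have -> : fpairing m w (projd (n - m) e) = fpairing m w (rawd e).
  apply: eq_bigr => I /eqP cI; rewrite /projd.
  have -> : #|~: I| == (n - m)%N by rewrite cardsCs setCK card_ord cI.
  by rewrite pairing_suppr.
rewrite -fpairing_rawd dformE big_distrr; apply: eq_bigr => I cI /=.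
by rewrite /projd /eformZ cI pairingZl pairing_suppl // mulrCA.
Qed.

Lemma fpairing_nondeg m e : (m <= n)%N -> isForm psi (n - m) e ->
  (forall w, isForm psi m w -> fpairing m w e = 0) -> e = eform0 R d.
Proof.
move=> mn eF e0; apply: functional_extensionality_dep => I.
have [cI|/eqP cI] := eqVneq #|I| (n - m)%N; last by rewrite (proj2 eF).
rewrite -(form_phase I eF); set J := ~: I.
have IJ : I = ~: J by rewrite setCK.
apply: (pairing_nondeg IJ) => X.
(* A test form concentrated at [J]; the component type depends on the index, hence the transport
   along [J = K]. *)
pose w : eform := fun K => if J =P K is ReflectT JK
  then eq_rect J (fun K => op R d K) (supp J *m X *m supp J) K JK else 0.
have wJ : w J = supp J *m X *m supp J.
  by rewrite /w; case: eqP => // JJ; rewrite (eq_axiomK JJ).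
have w0 K : K != J -> w K = 0.
  by move=> KJ; rewrite /w; case: eqP => // JK; rewrite JK eqxx in KJ.
have cJ : #|J| = m by rewrite cardsCs setCK card_ord cI subKn.
have wF : isForm psi m w.
  split=> K cK; last by apply: w0; apply: contra_notN cK => /eqP->.
  have [->|/w0->] := eqVneq K J; last by rewrite mulmx0 mul0mx.
  rewrite wJ !mulmxA supp_idem -!mulmxA.
  by rewrite !(mulmxA _ _ (supp J)) -(mulmxA _ (supp J) (supp J)) supp_idem.
have := e0 w wF; rewrite /fpairing (bigD1 J) ?cJ //= big1 => [|K /andP[_ /w0->]].
  rewrite addr0 wJ -IJ => /(congr1 ( *%R (eps J))).
  by rewrite mulrA shsign_sqr mul1r mulr0.
by rewrite -(scale0r 0) pairingZl mul0r mulr0.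
Qed.

(** The Schmidt bases at [I] and the phase used by [star] come from separate choices; [polarE]
    reconciles them. *)
Lemma pairing_star I w e :
  let A := schmidtA (schm psi I) in let l := diag_mx (schmidtl (schm psi I)) in
  eps I * pairing (w I) (star (adjf e) (~: I)) =
  \tr (l *m (adj A *m w I *m A) *m l *m adj (adj A *m e I *m A)).
Proof.
move=> A l; have s := schm_svd psi I; rewrite (starE _ (erefl (~: I))).
rewrite pairingC pairingZl pairingC mulrA shsign_sqr mul1r pairingE.
by rewrite -phase_tr {1 2}/phase (polarE s) (svd_trace s).
Qed.

(** * The inner product and the codifferential *)

Hypothesis hpsi : \sum_x `|psi x 0| ^+ 2 = 1.

(** The unit norm of [psi] enters here: on the empty set the reduced density is a scalar, the
    squared norm. *)
Lemma amp_set0 : amp psi set0 (~: set0) *m adj (amp psi set0 (~: set0)) = 1%:M.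
Proof.
rewrite -rhoE [rho _ _]mx1_mxtrace ?N_set0 //; congr (_%:M).
have E0 (a b : 'I_(N d (set0 : {set 'I_n}))) : a = b by apply: ord_set0.
have a0 : 'I_(N d (set0 : {set 'I_n})) by rewrite N_set0; apply: ord0.
rewrite /mxtrace (big_pred1 a0) => [|a]; last by rewrite (E0 a a0) /= eqxx.
rewrite mxE -hpsi; apply: eq_big => [x|x _]; first by apply/eqP; apply: E0.
rewrite (big_pred1 x) ?normCK // => y; rewrite [_ == a0](introT eqP (E0 _ _)) /=.
apply/eqP/eqP => [xy|->//]; apply: (conf_inj (E0 _ _)); exact: esym xy.
Qed.

Lemma ipE k w e : ip psi k w e = fpairing k w (star (adjf e)).
Proof.
rewrite /ip /fpairing; case: eqP => [->|_].
  rewrite (big_pred1 set0) => [|I]; last by rewrite cards_eq0.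
  rewrite pairing_star; set s := schm psi set0.
  have adj1 : adj (1%:M : 'M[C]_(N d (set0 : {set 'I_n}))) = 1%:M.
    by apply/matrixP=> i j; rewrite !mxE eq_sym rmorph_nat.
  (* In degree 0 [ip] carries no Schmidt weights. Both [amp] at the empty set and the identity have
     [M *m adj M = 1], so uniqueness of square roots gives [A L adj A = 1], which absorbs the
     weights. *)
  have svd1 : svd 1%:M (const_mx 1) 1%:M (1%:M : 'M[C]_(N d (set0 : {set 'I_n}))).
    split; rewrite ?adj1 ?mulmx1 ?trmx1 //; first by move=> i; rewrite mxE ltr01.
    by rewrite mul1mx diag_const_mx mulmx1.
  have := svd_sqrt_uniq (schm_svd psi set0) svd1.
  rewrite amp_set0 adj1 !mulmx1 diag_const_mx mul1mx => /(_ erefl) AlA.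
  transitivity (\tr (w set0 *m adj (e set0))).
    by rewrite mx1_mxtrace_mul_adj // N_set0.
  rewrite -[w set0 in LHS]mul1mx -[1%:M *m _ in LHS]mulmx1 -AlA -/s.
  rewrite [in RHS]adjM [in RHS]adjM adjK -!mulmxA mxtrace_mulC.
  by rewrite -!mulmxA.
apply: eq_bigr => I _; rewrite pairing_star; set s := schm psi I.
have entry al be (X : op R d I) :
    (adj (sa al) *m X *m sa be) 0 0 = (adj (schmidtA s) *m X *m schmidtA s) al be.
  rewrite !mxE; apply: eq_bigr => b _; rewrite !mxE; congr (_ * _).
  by apply: eq_bigr => a _; rewrite !adjE !mxE.
apply: eq_bigr => al _; rewrite mxE; apply: eq_bigr => be _.
rewrite !entry mul_mx_diag mxE mul_diag_mx mxE adjE.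
rewrite [schmidtl _ 0 al]mxE [schmidtl _ 0 be]mxE.
by rewrite (mulrAC (slam al)).
Qed.

Lemma ip_dform m w e :
  ip psi m.+1 (dform psi m w) e =
  dcoef m * (-1) ^+ m * fpairing m w (projd (n - m) (star (adjf e))).
Proof. by rewrite ipE fpairing_dform. Qed.

Lemma adjf_eq0 w : adjf w = eform0 R d -> w = eform0 R d.
Proof.
move=> w0; rewrite -(adjfK w) w0; apply: functional_extensionality_dep => I.
by apply/matrixP=> a b; rewrite adjE !mxE rmorph0.
Qed.

Lemma star_eq0 k w : (k <= n)%N -> isForm psi k w -> star w = eform0 R d ->
  w = eform0 R d.
Proof.
move=> kn wF w0; apply: (@eformZ_eq0 ((-1) ^+ (k * (n - k)))); first by rewrite signr_eq0.
rewrite -(starK kn wF) w0; apply: functional_extensionality_dep => I.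
by rewrite /star trmx0 mulmx0 mul0mx scaler0.
Qed.

Lemma ip_nondeg m nu : (m <= n)%N -> isForm psi m nu ->
  (forall w, isForm psi m w -> ip psi m w nu = 0) -> nu = eform0 R d.
Proof.
move=> mn nuF nu0; apply: adjf_eq0; apply: (star_eq0 mn (form_adj nuF)).
apply: (fpairing_nondeg mn); first exact/star_form/form_adj.
by move=> w wF; rewrite -ipE nu0.
Qed.

(** The adjoint exists by an explicit formula: moving [d] across the pairing leaves [projd] of
    [star (adjf e)], and one more [star] and [adjf] turn this into a form representing the
    functional. *)
Lemma codiff_spec m e : (m < n)%N -> isForm psi m.+1 e ->
  isForm psi m (codiff psi m.+1 e) /\
  forall w, isForm psi m w ->
    ip psi m.+1 (dform psi m w) e = ip psi m w (codiff psi m.+1 e).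
Proof.
move=> mn eF; apply: (epsilon_spec (inhabits (eform0 R d)) (fun nu =>
  isForm psi m nu /\
  forall w, isForm psi m w -> ip psi m.+1 (dform psi m w) e = ip psi m w nu)).
have mn' := ltnW mn; set G := projd (n - m) (star (adjf e)).
have GF : isForm psi (n - m) G by apply: projd_form.
have sGF : isForm psi m (star G) by have := star_form GF; rewrite subKn.
(* The factor picked up from [d], times the sign that cancels the one from applying [star] twice. *)
pose c : C := dcoef m * (-1) ^+ m * (-1) ^+ (m * (n - m)).
exists (adjf (eformZ c (star G))); split; first exact/form_adj/formZ.
move=> w wF; rewrite ip_dform ipE adjfK starZ (starK (leq_subr _ _) GF) subKn //.
rewrite eformZZ fpairingZr -/G; congr (_ * _).
by rewrite /c (mulnC (n - m)%N) -mulrA -expr2 sqrr_sign mulr1.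
Qed.

(** By [ip_dform], testing [codiff e] against forms amounts to pairing them with [projd] of
    [star (adjf e)], so nondegeneracy makes both vanish together; the adjoint can be removed because
    it commutes with [star] and [projd]. *)
Lemma codiff_eq0 k e : (k <= n)%N -> isForm psi k e ->
  (forall I, codiff psi k e I = 0) <-> (forall I, dform psi (n - k) (star e) I = 0).
Proof.
case: k => [|m] mn eF.
  (* For [k = 0] both sides hold: [codiff] is zero by definition, and a coboundary from degree [n]
     would need an index set of [n + 1] elements. *)
  split=> _ I; rewrite // dformE /eformZ /projd subn0.
  case: eqP => cI; last by rewrite scaler0.
  by have := max_card (mem I); rewrite cI card_ord ltnn.
have mn' := ltnW mn; have [nuF nuE] := codiff_spec mn eF.
have dE : dform psi (n - m.+1) (star e) =
    eformZ (dcoef (n - m.+1)) (adjf (projd (n - m) (star (adjf e)))).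
  by rewrite dformE subnSK // -projd_adj -star_adj adjfK.
split=> [nu0 I|d0].
  have {}nu0 : codiff psi m.+1 e = eform0 R d by apply: functional_extensionality_dep.
  suff G0 : projd (n - m) (star (adjf e)) = eform0 R d.
    by rewrite dE G0; apply/matrixP => a b; rewrite mxE adjE !mxE rmorph0 mulr0.
  apply: (fpairing_nondeg mn' (projd_form _ _)) => w wF.
  have /eqP := nuE w wF; rewrite nu0 ip_dform ipE.
  have -> : eform0 R d = eformZ 0 (eform0 R d).
    by apply: functional_extensionality_dep => J; rewrite /eformZ scaler0.
  rewrite adjfZ starZ fpairingZr rmorph0 mul0r mulf_eq0 mulf_eq0 (negbTE (dcoef_neq0 m)) signr_eq0.
  by move=> /eqP.
have {}d0 : dform psi (n - m.+1) (star e) = eform0 R d by apply: functional_extensionality_dep.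
have G0 : projd (n - m) (star (adjf e)) = eform0 R d.
  by apply: adjf_eq0; apply: (eformZ_eq0 (dcoef_neq0 (n - m.+1))); rewrite -dE.
suff -> : codiff psi m.+1 e = eform0 R d by [].
apply: (ip_nondeg mn' nuF) => w wF; rewrite -nuE // ip_dform G0.
have -> : eform0 R d = eformZ 0 (eform0 R d).
  by apply: functional_extensionality_dep => I; rewrite /eformZ scaler0.
by rewrite fpairingZr mul0r mulr0.
Qed.

(** * Harmonic forms and the isomorphism *)

Lemma HarmE k w : (k <= n)%N ->
  Harm psi k w <-> isForm psi k w /\ (forall I, dform psi k w I = 0) /\
                   (forall I, dform psi (n - k) (star w) I = 0).
Proof.
move=> kn; split=> -[wF [dw cw]]; have [cd dc] := codiff_eq0 kn wF.
  exact: conj wF (conj dw (cd cw)).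
exact: conj wF (conj dw (dc cw)).
Qed.

Lemma HarmZ k a w : (k <= n)%N -> Harm psi k w -> Harm psi k (eformZ a w).
Proof.
move=> kn /(HarmE _ kn)[wF [dw cw]]; apply/(HarmE _ kn).
split; first exact: formZ.
by split=> I; rewrite ?starZ dformE projdZ /eformZ scalerA mulrC -scalerA;
  [have := dw I | have := cw I]; rewrite dformE /eformZ => ->; rewrite scaler0.
Qed.

Lemma Harm_star k w : (k <= n)%N -> Harm psi k w -> Harm psi (n - k) (star w).
Proof.
(* Coclosedness of [star w] means closedness of [star (star w)], which is this signed multiple of
   [w]. *)
move=> kn wH; have [_ [dw _]] := HarmZ ((-1) ^+ (k * (n - k))) kn wH.
have [wF [_ cw]] := (HarmE w kn).1 wH.
apply/(HarmE _ (leq_subr _ _)); split; first exact: star_form.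
split; first exact: cw.
by move=> I; rewrite (subKn kn) (starK kn wF).
Qed.

End EntanglementForms.

Theorem theorem3 (R : realType) (n : nat) (d : 'I_n -> nat)
    (psi : vec R d [set: 'I_n])
    (hpsi : \sum_x `|psi x 0| ^+ 2 = 1) (k : nat) (hk : (k <= n)%N) :
  exists (f g : eform R d -> eform R d),
    (forall (a : complex R) w e, Harm psi k w -> Harm psi k e ->
       forall I, f (eformD (eformZ a w) e) I = (eformD (eformZ a (f w)) (f e)) I) /\
    (forall w, Harm psi k w -> Harm psi (n - k) (f w)) /\
    (forall e, Harm psi (n - k) e -> Harm psi k (g e)) /\
    (forall w, Harm psi k w -> forall I, g (f w) I = w I) /\
    (forall e, Harm psi (n - k) e -> forall I, f (g e) I = e I).
Proof.
(* The sign of [star] applied twice. It is symmetric in [k] and [n - k], so [star] rescaled by it is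
   a two-sided inverse. *)
pose s : R[i] := (-1) ^+ (k * (n - k)).
have ss (w : eform R d) : eformZ s (eformZ s w) = w.
  rewrite eformZZ -expr2 sqrr_sign; apply: functional_extensionality_dep => I.
  exact: scale1r.
exists (star psi), (fun e => eformZ s (star psi e)).
split; first by move=> a w e _ _ I; rewrite starD starZ.
split; first by move=> w; apply: Harm_star.
split.
  move=> e eH; have := Harm_star hpsi (leq_subr _ _) eH.
  rewrite (subKn hk); exact: HarmZ.
split; first by move=> w [wF _] I; rewrite (starK hk wF) ss.
by move=> e [eF _] I; rewrite starZ (starK (leq_subr _ _) eF) (subKn hk) mulnC ss.
Qed.
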